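(* Let $P=at^2+bt+c\in\mathbb{S}[t]$ be a quadratic split quaternion polynomial whose coefficients $a,b,c\in\mathbb{S}$ are linearly independent over $\mathbb{R}$. Then $P$ admits a factorization.
   Context: The algebra $\mathbb{S}$ of split quaternions is the four-dimensional real associative unital algebra with basis $1,\mathbf{i},\mathbf{j},\mathbf{k}$ and multiplication determined by $\mathbf{i}^2=-1$, $\mathbf{j}^2=\mathbf{k}^2=1$, $\mathbf{i}\mathbf{j}\mathbf{k}=1$ (so $\mathbf{i},\mathbf{j},\mathbf{k}$ pairwise anti-commute and $\mathbf{i}\mathbf{j}=\mathbf{k}$). $\mathbb{S}[t]$ is the ring of polynomials in one indeterminate $t$ over $\mathbb{S}$, where $t$ commutes with all coefficients. A quadratic polynomial $P=at^2+bt+c\in\mathbb{S}[t]$ admits a factorization if there exist split quaternions $h_1,h_2\in\mathbb{S}$ such that $P=a(t-h_1)(t-h_2)$.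
   Formalization: The leading coefficient a is additionally assumed invertible; for non-invertible a with a, b, c linearly independent no factorization a(t-h1)(t-h2) exists (e.g. a=1+j, b=1, c=i), so the claim fails there. *)

(* Defs.v *)
From HB Require Import structures.
From mathcomp Require Import all_boot all_order all_algebra.
From mathcomp Require Import reals.
From mathcomp Require Import ring.

Set Implicit Arguments.
Unset Strict Implicit.
Unset Printing Implicit Defensive.

Import Order.TTheory GRing.Theory Num.Theory.
Local Open Scope ring_scope.

(* [SQuat x0 x1 x2 x3] is x0 + x1 i + x2 j + x3 k. *)
Record squat (R : Type) := SQuat { sq0 : R; sq1 : R; sq2 : R; sq3 : R }.

Section SplitQuaternionRing.
Variable R : fieldType.
Local Notation S := (squat R).
Implicit Types x y z : S.

Definition sq_row x : 'rV[R]_4 :=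
  \row_i [:: sq0 x; sq1 x; sq2 x; sq3 x]`_i.
Definition row_sq (v : 'rV[R]_4) : S :=
  SQuat (v 0 (inord 0)) (v 0 (inord 1)) (v 0 (inord 2)) (v 0 (inord 3)).

Lemma sq_rowK : cancel sq_row row_sq.
Proof. by case=> a b c d; rewrite /row_sq !mxE !inordK. Qed.

Lemma row_sqK : cancel row_sq sq_row.
Proof.
move=> v; apply/rowP=> i; rewrite mxE.
by case: i => [[|[|[|[|i]]]] Hi] //=; congr (v 0 _); apply/val_inj;
  rewrite /= inordK.
Qed.

HB.instance Definition _ := Choice.copy S (can_type sq_rowK).

Lemma sq_eqP x y : sq0 x = sq0 y -> sq1 x = sq1 y -> sq2 x = sq2 y ->
  sq3 x = sq3 y -> x = y.
Proof. by case: x y => [????] [????] /= -> -> -> ->. Qed.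

Definition sq_zero : S := SQuat 0 0 0 0.
Definition sq_opp x : S := SQuat (- sq0 x) (- sq1 x) (- sq2 x) (- sq3 x).
Definition sq_add x y : S :=
  SQuat (sq0 x + sq0 y) (sq1 x + sq1 y) (sq2 x + sq2 y) (sq3 x + sq3 y).
Definition sq_scale (r : R) x : S :=
  SQuat (r * sq0 x) (r * sq1 x) (r * sq2 x) (r * sq3 x).
Definition sq_one : S := SQuat 1 0 0 0.

(* Bilinear extension of i^2 = -1, j^2 = k^2 = 1, ij = -ji = k,
   jk = -kj = -i, ki = -ik = j. *)
Definition sq_mul x y : S :=
  SQuat
    (sq0 x * sq0 y - sq1 x * sq1 y + sq2 x * sq2 y + sq3 x * sq3 y)
    (sq0 x * sq1 y + sq1 x * sq0 y - sq2 x * sq3 y + sq3 x * sq2 y)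
    (sq0 x * sq2 y + sq2 x * sq0 y - sq1 x * sq3 y + sq3 x * sq1 y)
    (sq0 x * sq3 y + sq3 x * sq0 y + sq1 x * sq2 y - sq2 x * sq1 y).

Local Ltac sq_ring := repeat case=> ????; apply: sq_eqP => /=; ring.

Fact sq_addA : associative sq_add. Proof. sq_ring. Qed.
Fact sq_addC : commutative sq_add. Proof. sq_ring. Qed.
Fact sq_add0 : left_id sq_zero sq_add. Proof. sq_ring. Qed.
Fact sq_addN : left_inverse sq_zero sq_opp sq_add. Proof. sq_ring. Qed.
HB.instance Definition _ :=
  GRing.isZmodule.Build S sq_addA sq_addC sq_add0 sq_addN.

Fact sq_mulA : associative sq_mul. Proof. sq_ring. Qed.
Fact sq_mul1l : left_id sq_one sq_mul. Proof. sq_ring. Qed.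
Fact sq_mul1r : right_id sq_one sq_mul. Proof. sq_ring. Qed.
Fact sq_mulDl : left_distributive sq_mul +%R. Proof. sq_ring. Qed.
Fact sq_mulDr : right_distributive sq_mul +%R. Proof. sq_ring. Qed.
Fact sq_one_neq0 : sq_one != 0.
Proof. by apply/eqP => -[] /eqP; rewrite oner_eq0. Qed.
HB.instance Definition _ := GRing.Zmodule_isNzRing.Build S
  sq_mulA sq_mul1l sq_mul1r sq_mulDl sq_mulDr sq_one_neq0.

Lemma sq_relations (i j k : S) :
  i = SQuat 0 1 0 0 -> j = SQuat 0 0 1 0 -> k = SQuat 0 0 0 1 ->
  [/\ i * i = -1, j * j = 1, k * k = 1 & i * j * k = 1]
  /\ [/\ i * j = k, j * i = - k, k * j = - (j * k) & k * i = - (i * k)].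
Proof. by move=> -> -> ->; split; split; apply: sq_eqP => /=; ring. Qed.

Fact sq_scaleA a b x : sq_scale a (sq_scale b x) = sq_scale (a * b) x.
Proof. move: x; sq_ring. Qed.
Fact sq_scale1 : left_id 1 sq_scale. Proof. sq_ring. Qed.
Fact sq_scaleDr : right_distributive sq_scale +%R.
Proof. move=> r; sq_ring. Qed.
Fact sq_scaleDl x : {morph sq_scale^~ x : a b / a + b}.
Proof. move=> r s; move: x; sq_ring. Qed.
HB.instance Definition _ := GRing.Zmodule_isLmodule.Build R S
  sq_scaleA sq_scale1 sq_scaleDr sq_scaleDl.

Fact sq_scaleAl (r : R) x y : r *: (x * y) = (r *: x) * y.
Proof. move: x y; sq_ring. Qed.
HB.instance Definition _ := GRing.Lmodule_isLalgebra.Build R S sq_scaleAl.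
Fact sq_scaleAr (r : R) x y : r *: (x * y) = x * (r *: y).
Proof. move: x y; sq_ring. Qed.
HB.instance Definition _ := GRing.Lalgebra_isAlgebra.Build R S sq_scaleAr.

Fact sq_vect_axiom : Vector.axiom 4 S.
Proof.
exists sq_row; last by exists row_sq; [exact: sq_rowK | exact: row_sqK].
move=> r x y; apply/rowP=> i; rewrite !mxE.
by case: i => [[|[|[|[|i]]]] Hi].
Qed.
HB.instance Definition _ := Lmodule_hasFinDim.Build R S sq_vect_axiom.

Definition sq_conj x : S := SQuat (sq0 x) (- sq1 x) (- sq2 x) (- sq3 x).
Definition sq_norm x : R :=
  sq0 x ^+ 2 + sq1 x ^+ 2 - sq2 x ^+ 2 - sq3 x ^+ 2.

Lemma sq_mul_conj x : x * sq_conj x = sq_norm x *: 1.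
Proof. rewrite /sq_norm; move: x; sq_ring. Qed.
Lemma sq_conj_mul x : sq_conj x * x = sq_norm x *: 1.
Proof. rewrite /sq_norm; move: x; sq_ring. Qed.
Lemma sq_normM x y : sq_norm (x * y) = sq_norm x * sq_norm y.
Proof. by case: x y => [????] [????]; rewrite /sq_norm /=; ring. Qed.

Definition sq_unit : pred S := fun x => sq_norm x != 0.
Definition sq_inv x : S :=
  if sq_unit x then (sq_norm x)^-1 *: sq_conj x else x.

Fact sq_mulVr : {in sq_unit, left_inverse 1 sq_inv *%R}.
Proof.
move=> x ux; have {}ux : sq_norm x != 0 := ux; rewrite /sq_inv ifT // -scalerAl.
by rewrite sq_conj_mul scalerA mulVf // scale1r.
Qed.

Fact sq_divrr : {in sq_unit, right_inverse 1 sq_inv *%R}.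
Proof.
move=> x ux; have {}ux : sq_norm x != 0 := ux; rewrite /sq_inv ifT // -scalerAr.
by rewrite sq_mul_conj scalerA mulVf // scale1r.
Qed.

Fact sq_unitP x y : y * x = 1 /\ x * y = 1 -> sq_unit x.
Proof.
case=> _ /(congr1 sq_norm); rewrite sq_normM /sq_unit => xy1.
apply/eqP => x0; move/eqP: xy1; rewrite x0 mul0r /sq_norm /=.
by rewrite expr1n !expr0n /= !subr0 addr0 eq_sym oner_eq0.
Qed.

Fact sq_inv_out : {in [predC sq_unit], sq_inv =1 id}.
Proof. by move=> x; rewrite inE /sq_inv -topredE /= => /negbTE ->. Qed.
HB.instance Definition _ := GRing.NzRing_hasMulInverse.Build S
  sq_mulVr sq_divrr sq_unitP sq_inv_out.

End SplitQuaternionRing.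

Lemma lann_factor (T : nzRingType) (d a b c h1 h2 : T) :
  d * a = 0 ->
  a%:P * 'X^2 + b%:P * 'X + c%:P = a%:P * ('X - h1%:P) * ('X - h2%:P) ->
  d * b = 0 /\ d * c = 0.
Proof.
move=> da eP.
have cP : d%:P * (a%:P * 'X^2 + b%:P * 'X + c%:P) = 0.
  by rewrite eP !mulrA -polyCM da !mul0r.
have E i := congr1 (fun p : {poly T} => p`_i) cP.
split.
  by move: (E 1%N); rewrite coefCM !coefD coefCM coefXn mulr0 add0r
    coefMX coefC coefC /= addr0 coef0.
by move: (E 0%N); rewrite coefCM !coefD coefCM coefXn mulr0 add0r
  coefMX /= add0r coefC coef0.
Qed.

(* If a is not a unit then a S is a right ideal of dimension at most 2, so the
   coefficients of a (t - h1) (t - h2) cannot be linearly independent: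
   invertibility of a is necessary for the factorization theorem. *)
Lemma factor_lead_unit (R : realFieldType) (a b c h1 h2 : squat R) :
  free [:: a; b; c] ->
  a%:P * 'X^2 + b%:P * 'X + c%:P = a%:P * ('X - h1%:P) * ('X - h2%:P) ->
  a \is a GRing.unit.
Proof.
move=> fabc eP; apply: contraT => Na.
have na0 : sq_norm a = 0 by apply/eqP; apply: contraNT Na.
have ca : sq_conj a * a = 0 by rewrite sq_conj_mul na0 scale0r.
have [cb cc] := lann_factor ca eP.
pose f : 'End(squat R) := linfun (fun x => sq_conj a * x).
have fE x : f x = sq_conj a * x.
  suff lf : linear (fun x : squat R => sq_conj a * x).
    pose g := GRing.isLinear.Build R (squat R) (squat R) _ _ lf.
    pose F : {linear squat R -> squat R} :=
      HB.pack (fun x : squat R => sq_conj a * x) g.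
    by rewrite /f -[LHS]/(linfun F x) lfunE.
  by move=> r u v; rewrite mulrDr scalerAr.
have a0 : a != 0.
  by apply: (free_not0 fabc); rewrite mem_head.
have kdim : (3 <= \dim (lker f))%N.
  have <- : \dim <<[:: a; b; c]>>%VS = 3%N by apply/eqP.
  apply/dimvS/span_subvP => x; rewrite !inE memv_ker fE.
  by case/or3P=> /eqP ->; rewrite ?ca ?cb ?cc.
pose i0 : squat R := SQuat 0 1 0 0.
have rdim : (2 <= \dim (limg f))%N.
  have d0 : sq_conj a != 0.
    apply: contra a0 => /eqP[] a_0 /eqP; rewrite oppr_eq0 => /eqP a_1 /eqP.
    rewrite oppr_eq0 => /eqP a_2 /eqP; rewrite oppr_eq0 => /eqP a_3.
    by apply/eqP/sq_eqP.
  have <- : \dim <<[:: sq_conj a * i0; sq_conj a]>>%VS = 2%N.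
    apply/eqP; rewrite -[_ == _]/(free _) free_cons span_seq1 seq1_free d0.
    rewrite andbT; apply/negP => /vlineP[r di].
    have ui : i0 - r *: 1 \is a GRing.unit.
      rewrite -[_ \is a _]/(sq_norm _ != 0).
      have -> : sq_norm (i0 - r *: 1) = r ^+ 2 + 1 by rewrite /sq_norm /=; ring.
      by rewrite gt_eqF // ltr_wpDl // sqr_ge0.
    move/eqP: d0; apply; apply: (mulIr ui); rewrite mul0r mulrBr di.
    by rewrite -scalerAr mulr1 subrr.
  apply/dimvS/span_subvP => x; rewrite !inE => /orP[] /eqP ->.
    by rewrite -fE memv_img ?memvf.
  by rewrite -[sq_conj a]mulr1 -fE memv_img ?memvf.
have := limg_ker_dim f fullv; rewrite capfv dimvf => D.
by move: (leq_add kdim rdim); rewrite D.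
Qed.

(* Main.v *)
(* Dividing by a and translating t by half the real part of b, it suffices to
   find a right zero h of t^2 + b t + c with b purely vectorial. If h has trace T
   and norm n then h^2 = T h - n, so (b + T) h = n - c; when b + T is invertible
   this determines h, and T, n are subject to two scalar equations whose
   resolvent is a real cubic in T^2. A suitable root exists unless the plane
   spanned by b and the vectorial part of c is degenerate. Such a plane contains
   a null vector orthogonal to it, and over a split quaternion basis adapted to
   this null vector (matrix units) a zero can be written down explicitly. *)
Require Import Defs.
From mathcomp Require Import all_boot all_order all_algebra.
From mathcomp Require Import reals.
From mathcomp Require Import ring lra.

Import Order.TTheory GRing.Theory Num.Theory.
Local Open Scope ring_scope.

(** * The norm form, its polarization and its null vectors *)

Definition sq_dot {R : fieldType} (x y : squat R) : R :=
  sq0 x * sq0 y + sq1 x * sq1 y - sq2 x * sq2 y - sq3 x * sq3 y.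

Local Ltac sq_ring := repeat case=> ????; rewrite /sq_norm /sq_dot /=;
  intros; subst; apply: sq_eqP => /=; ring.

Lemma sq_cayley_hamilton {R : fieldType} {x : squat R} :
  x * x = (2 * sq0 x) *: x - sq_norm x *: 1.
Proof. by move: x; sq_ring. Qed.

Lemma sq_anticomm {R : fieldType} {x y : squat R} :
  sq0 x = 0 -> sq0 y = 0 -> x * y + y * x = - (2 * sq_dot x y) *: 1.
Proof. by move: x y; sq_ring. Qed.

Lemma sq_pure_sqr {R : fieldType} {x : squat R} :
  sq0 x = 0 -> x * x = - sq_norm x *: 1.
Proof. by move=> x0; rewrite sq_cayley_hamilton x0 mulr0 scale0r sub0r scaleNr. Qed.

(** Were this coefficient zero too, the norm would be -(e2^2 + e3^2), which is definite. *)
Lemma sq_null_sq1_neq0 {R : realFieldType} {e : squat R} :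
  sq0 e = 0 -> e != 0 -> sq_norm e = 0 -> sq1 e != 0.
Proof.
case: e => e0 e1 e2 e3 /= ->; rewrite /sq_norm /= => ne N.
apply: contra_neq ne => e1E; rewrite {}e1E in N *.
have e2E : e2 = 0 by nra.
have e3E : e3 = 0 by nra.
by rewrite e2E e3E.
Qed.

(* The pure split quaternions carry a form of Witt index 1. *)
Lemma sq_null_collinear {R : realFieldType} {e w : squat R} :
  sq0 e = 0 -> sq0 w = 0 -> e != 0 -> sq_norm e = 0 -> sq_norm w = 0 ->
  sq_dot e w = 0 -> w = (sq1 w / sq1 e) *: e.
Proof.
move=> e0 w0 ne Ne; have e1n := sq_null_sq1_neq0 e0 ne Ne.
case: e w e0 w0 e1n {ne} Ne => [e0 e1 e2 e3] [w0 w1 w2 w3] /= -> -> e1n.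
rewrite /sq_norm /sq_dot /= => Ne Nw D.
(* Lagrange's identity: nullity and orthogonality turn its right side into e1^2 w1^2 - (e1 w1)^2. *)
have k1 : (e2 * w3 - e3 * w2) ^+ 2 = 0.
  have -> : (e2 * w3 - e3 * w2) ^+ 2 =
    (e2 ^+ 2 + e3 ^+ 2) * (w2 ^+ 2 + w3 ^+ 2) - (e2 * w2 + e3 * w3) ^+ 2 by ring.
  have -> : e2 ^+ 2 + e3 ^+ 2 = e1 ^+ 2 by lra.
  have -> : w2 ^+ 2 + w3 ^+ 2 = w1 ^+ 2 by lra.
  have -> : e2 * w2 + e3 * w3 = e1 * w1 by lra.
  by ring.
have aux x y z t : (x * y - z * t) ^+ 2 = 0 -> x * y = z * t :> R.
  by move/eqP; rewrite sqrf_eq0 subr_eq0 => /eqP.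
(* The same substitutions reduce this square, and that for [k3], to the one in [k1]. *)
have k2 : e1 * w2 = w1 * e2.
  apply: aux; rewrite -[RHS]k1.
  have -> : (e1 * w2 - w1 * e2) ^+ 2 =
    e1 ^+ 2 * w2 ^+ 2 + w1 ^+ 2 * e2 ^+ 2 - 2 * (e1 * w1) * (e2 * w2) by ring.
  have -> : e1 ^+ 2 = e2 ^+ 2 + e3 ^+ 2 by lra.
  have -> : w1 ^+ 2 = w2 ^+ 2 + w3 ^+ 2 by lra.
  have -> : e1 * w1 = e2 * w2 + e3 * w3 by lra.
  by ring.
have k3 : e1 * w3 = w1 * e3.
  apply: aux; rewrite -[RHS]k1.
  have -> : (e1 * w3 - w1 * e3) ^+ 2 =
    e1 ^+ 2 * w3 ^+ 2 + w1 ^+ 2 * e3 ^+ 2 - 2 * (e1 * w1) * (e3 * w3) by ring.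
  have -> : e1 ^+ 2 = e2 ^+ 2 + e3 ^+ 2 by lra.
  have -> : w1 ^+ 2 = w2 ^+ 2 + w3 ^+ 2 by lra.
  have -> : e1 * w1 = e2 * w2 + e3 * w3 by lra.
  by ring.
apply: sq_eqP => /=; first by rewrite mulr0.
- by rewrite divfK.
- by rewrite mulrAC -k2 [e1 * w2]mulrC mulfK.
- by rewrite mulrAC -k3 [e1 * w3]mulrC mulfK.
Qed.

(** * Frames adapted to a null vector *)

(* In a suitable matrix model u = diag(p, -p), e = E12 and f = 2 p E21. *)
Lemma sq_null_frame {R : realFieldType} {u e : squat R} :
  sq0 u = 0 -> sq0 e = 0 -> e != 0 -> sq_norm e = 0 -> sq_dot u e = 0 ->
  sq_norm u != 0 ->
  exists (p : R) (f : squat R),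
    [/\ p != 0, u * u = p ^+ 2 *: 1 & u * e = p *: e /\ e * u = - p *: e] /\
    [/\ u * f = - p *: f, f * u = p *: f, f * f = 0,
        e * f = p *: 1 + u & f * e = p *: 1 - u].
Proof.
move=> u0 e0 ne Ne D Nu; have e1n := sq_null_sq1_neq0 e0 ne Ne.
have eu_anti : e * u = - (u * e).
  apply/eqP; rewrite -addr_eq0 addrC; apply/eqP.
  by rewrite sq_anticomm // D mulr0 oppr0 scale0r.
(* [u * e] is pure, null and orthogonal to [e], hence a multiple of it. *)
have [p ue] : exists p, u * e = p *: e.
  exists (sq1 (u * e) / sq1 e); apply: sq_null_collinear => //.
  - case: u e u0 e0 D {Nu ne Ne e1n eu_anti} => [????] [????] /= -> ->.
    by rewrite /sq_dot /= => D; lra.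
  - by rewrite sq_normM Ne mulr0.
  - case: u e u0 e0 {D Nu ne Ne e1n eu_anti} => [????] [????] /= -> ->.
    by rewrite /sq_dot /=; ring.
have p2 : - sq_norm u = p ^+ 2.
  have : u * (u * e) = p ^+ 2 *: e by rewrite ue -scalerAr ue scalerA.
  rewrite mulrA sq_pure_sqr // -scalerAl mul1r => /eqP.
  rewrite -subr_eq0 -scalerBl scaler_eq0 (negbTE ne) orbF subr_eq0.
  by move/eqP.
have pn : p != 0 by apply: contraNneq Nu => p0; rewrite -oppr_eq0 p2 p0 expr0n.
have uu : u * u = p ^+ 2 *: 1 by rewrite -p2 sq_pure_sqr.
have eu : e * u = - p *: e by rewrite eu_anti ue scaleNr.
(* The component of i orthogonal to [u], since [sq_norm u] is -p^2; it anticommutes with [u]. *)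
pose k : squat R := SQuat 0 1 0 0 + (sq1 u / p ^+ 2) *: u.
have k0 : sq0 k = 0 by rewrite /k /= u0 mulr0 addr0.
have ku : k * u = - (u * k).
  apply/eqP; rewrite -addr_eq0; apply/eqP; rewrite sq_anticomm //.
  suff -> : sq_dot k u = 0 by rewrite mulr0 oppr0 scale0r.
  move: p2; rewrite /sq_dot /k /sq_norm /= u0 => p2.
  have -> : 0 + sq1 u / p ^+ 2 * 0 = 0 :> R by ring.
  transitivity (sq1 u * (1 - - (0 ^+ 2 + sq1 u ^+ 2 - sq2 u ^+ 2 - sq3 u ^+ 2)
     / p ^+ 2)); first by field.
  by rewrite p2 divff ?expf_neq0 // subrr mulr0.
have ek : e * k + k * e = - (2 * sq1 e) *: 1.
  rewrite sq_anticomm //; congr (- (2 * _) *: 1).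
  move: D; rewrite /sq_dot /k /= u0 e0 => D.
  transitivity (sq1 e + sq1 u / p ^+ 2 *
    (0 * 0 + sq1 u * sq1 e - sq2 u * sq2 e - sq3 u * sq3 e)).
    by field.
  by rewrite D mulr0 addr0.
(* [u] scales [v] by -p on both sides; the factor [k] in [f] flips the sign on the right. *)
pose v : squat R := p *: 1 - u.
have uv : u * v = - p *: v.
  rewrite /v mulrBr -scalerAr mulr1 uu.
  by rewrite scaleNr scalerBr opprB scalerA expr2.
have vu : v * u = - p *: v.
  by rewrite -uv /v mulrBl mulrBr -scalerAl -scalerAr mulr1 mul1r.
(* By [ek], this normalises [e * f + f * e] to 2p. *)
have [r rE] : exists r, r = - (2 * sq1 e)^-1 by eexists.
have [f fE] : exists f, f = r *: (v * k) by eexists.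
have uf : u * f = - p *: f by rewrite fE -scalerAr mulrA uv -scalerAl !scalerA mulrC.
have fu : f * u = p *: f.
  rewrite fE -scalerAl -mulrA ku mulrN mulrA vu -scalerAl scaleNr opprK.
  by rewrite !scalerA mulrC.
have ff : f * f = 0.
  have : (p + p) *: (f * f) = 0.
    have E : f * (u * f) = p *: (f * f) by rewrite mulrA fu -scalerAl.
    by rewrite scalerDl -{1}E uf -scalerAr scaleNr addNr.
  by move/eqP; rewrite scaler_eq0 -mulr2n mulrn_eq0 (negbTE pn) /= => /eqP.
have ev : e * v = (2 * p) *: e.
  rewrite /v mulrBr -scalerAr mulr1 eu scaleNr opprK -scalerDl.
  by congr (_ *: _); ring.
have sumf : e * f + f * e = (2 * p) *: 1.
  have -> : e * f = (r * (2 * p)) *: (e * k).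
    by rewrite fE -scalerAr mulrA ev -scalerAl scalerA.
  have -> : f * e = (r * (2 * p)) *: (k * e).
    rewrite fE -scalerAl -scalerA; congr (_ *: _).
    rewrite /v mulrBl mulrBl -scalerAl mul1r -scalerAl.
    have -> : u * k = - (k * u) by rewrite ku opprK.
    rewrite mulNr opprK -[k * u * e]mulrA ue -scalerAr -scalerDl.
    by congr (_ *: _); ring.
  rewrite -scalerDr ek scalerA; congr (_ *: _); rewrite rE.
  by field.
have diff : e * f - f * e = 2 *: u.
  have : u * (e * f + f * e) = p *: (e * f - f * e).
    by rewrite mulrDr !mulrA ue uf -!scalerAl scaleNr scalerBr.
  rewrite sumf -scalerAr mulr1 [2 * p]mulrC -scalerA.
  by move/(scalerI pn).
have twoI (x y : squat R) : (2 : R) *: x = 2 *: y -> x = y.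
  by apply: scalerI; rewrite pnatr_eq0.
exists p, f; do 2!split => //.
- apply: twoI; rewrite scalerDr -diff scalerA -sumf scaler_nat mulr2n.
  by rewrite addrACA subrr addr0.
- apply: twoI; rewrite scalerBr -diff scalerA -sumf scaler_nat mulr2n.
  by rewrite opprB [e * f + _]addrC addrACA subrr addr0.
Qed.

(** * Explicit zeros in the degenerate cases *)

Local Ltac sq_expand :=
  rewrite !(mulrDl, mulrDr) -?scalerAl -?scalerAr -?scalerAl ?(mulr1, mul1r).

Lemma sq_solve_degenerate {R : realFieldType} {b e : squat R} (k m : R) :
  sq0 b = 0 -> sq0 e = 0 -> e != 0 -> sq_norm e = 0 -> sq_dot b e = 0 ->
  sq_norm b != 0 ->
  exists h, h * h + b * h + (k *: 1 + m *: b + e) = 0.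
Proof.
move=> b0 e0 ne Ne D Nb.
have ee : e * e = 0 by rewrite sq_pure_sqr // Ne oppr0 scale0r.
have [p [f [[pn bb [be eb]] [bf fb ff ef fe]]]] := sq_null_frame b0 e0 ne Ne D Nb.
(* For trace p, b + p = diag(2p, 0) is singular. Then (b + p) h = n - c forces n = k - m p and fixes
   the first row of h; trace and norm give the second. *)
exists ((p / 2) *: 1 + (- (m / p + 2^-1)) *: b + (- (p^-1 / 2)) *: e
        + (m ^+ 2 + k) *: f).
sq_expand.
rewrite bb be eb bf fb ff ef fe ee.
clear - pn; case: b e f => [????] [????] [????].
by apply: sq_eqP => /=; field.
Qed.

Lemma sq_solve_null {R : realFieldType} {b u : squat R} (k : R) :
  sq0 u = 0 -> sq0 b = 0 -> b != 0 -> sq_norm b = 0 -> sq_dot u b = 0 ->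
  sq_norm u != 0 ->
  exists h, h * h + b * h + (k *: 1 + u) = 0.
Proof.
move=> u0 b0 nb Nb D Nu.
have bb : b * b = 0 by rewrite sq_pure_sqr // Nb oppr0 scale0r.
have [p [f [[pn _ _] [_ _ ff bf fb]]]] := sq_null_frame u0 b0 nb Nb D Nu.
(* Here b is E12 and u is diag(p, -p). This h is pure, with h^2 = p - k and b h = -(p + u). *)
exists ((k / p / 2 - 2^-1) *: b + (- 1) *: f).
sq_expand.
rewrite bb bf fb ff.
clear - pn; case: u => [????].
by apply: sq_eqP => /=; field.
Qed.

(** * Zeros of prescribed trace and norm *)

(* A zero of trace T and norm n satisfies h ^+ 2 = T h - n, hence
   (b + T) h = n - c. *)
Lemma sq_solve_trace_norm {R : realFieldType} {b c : squat R} (T n : R) :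
  sq0 b = 0 -> T ^+ 2 + sq_norm b != 0 ->
  T * (T ^+ 2 + sq_norm b) = T * (2 * n - 2 * sq0 c) - 2 * sq_dot b c ->
  n * (T ^+ 2 + sq_norm b) = sq_norm c - 2 * sq0 c * n + n ^+ 2 ->
  exists h, h * h + b * h + c = 0.
Proof.
move=> b0 Dn ET En.
pose D := T ^+ 2 + sq_norm b.
(* The inverse of b + T is (T - b) / D; [ET] and [En] make [h] have trace [T] and norm [n]. *)
pose h := D^-1 *: ((T *: 1 - b) * (n *: 1 - c)).
have bh : (b + T *: 1) * h = n *: 1 - c.
  rewrite /h -scalerAr mulrA.
  have -> : (b + T *: 1) * (T *: 1 - b) = D *: 1.
    rewrite /D; case: b b0 {h D Dn ET En} => [????] /= ->.
    by rewrite /sq_norm; apply: sq_eqP => /=; ring.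
  by rewrite -scalerAl mul1r scalerA mulVf // scale1r.
have h0 : 2 * sq0 h = T.
  have -> : 2 * sq0 h = D^-1 * (T * (2 * n - 2 * sq0 c) - 2 * sq_dot b c).
    rewrite /h /D; case: b c b0 {h bh D Dn ET En} => [????] [????] /= ->.
    by rewrite /sq_norm /sq_dot /=; ring.
  by rewrite -ET mulrC mulfK.
have hN : sq_norm h = n.
  have -> : sq_norm h =
      D^-1 ^+ 2 * (D * (sq_norm c - 2 * sq0 c * n + n ^+ 2)).
    rewrite /h /D; case: b c b0 {h bh h0 D Dn ET En} => [????] [????] /= ->.
    by rewrite /sq_norm /=; ring.
  by rewrite -En -/D; field.
exists h; rewrite sq_cayley_hamilton h0 hN.
move: bh; rewrite mulrDl -scalerAl mul1r => E.
rewrite addrAC; apply/eqP.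
have -> : T *: h - n *: 1 + c + b * h = (b * h + T *: h) - (n *: 1 - c).
  rewrite opprB [b * h + _]addrC [RHS]addrACA -[LHS]addrA [LHS]addrACA.
  by rewrite [- (n *: 1) + _]addrC.
by rewrite E subrr.
Qed.

(* Eliminating n leaves the cubic resolvent
   s (s + w) ^+ 2 - 4 v s - 4 g ^+ 2 = 0 for s = T ^+ 2, where w = B + 2 k and
   v = k ^+ 2 + N; its value at s = - B is four times the Gram determinant. *)
Lemma trace_norm_system {R : rcfType} {B N g : R} (k : R) :
  B * N - g ^+ 2 != 0 ->
  exists T n, [/\ T ^+ 2 + B != 0,
    T * (T ^+ 2 + B) = T * (2 * n - 2 * k) - 2 * g &
    n * (T ^+ 2 + B) = (k ^+ 2 + N) - 2 * k * n + n ^+ 2].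
Proof.
move=> G; pose w := B + 2 * k; pose v := k ^+ 2 + N.
have [g0|gn] := eqVneq g 0.
  have [Bn Nn] : B != 0 /\ N != 0.
    by move: G; rewrite g0 expr0n subr0 mulf_eq0 negb_or => /andP.
  (* T = 0 solves the first equation; the second becomes n^2 - w n + v = 0. *)
  have [le|lt] := lerP (4 * v) (w ^+ 2).
    exists 0, ((w + Num.sqrt (w ^+ 2 - 4 * v)) / 2).
    rewrite expr0n add0r g0; split => //; first by ring.
    have E : Num.sqrt (w ^+ 2 - 4 * v) ^+ 2 = w ^+ 2 - 4 * v.
      by rewrite sqr_sqrtr // subr_ge0.
    move: E; set q := Num.sqrt _; rewrite /w /v => E.
    by nra.
  (* For nonzero T the equations become 2 n = T^2 + w and n^2 = v, so n = q / 2 with q = sqrt(4 v),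
     and T^2 = q - w. *)
  have v0 : 0 <= 4 * v by apply: le_trans (ltW lt); rewrite sqr_ge0.
  have q2 : Num.sqrt (4 * v) ^+ 2 = 4 * v by rewrite sqr_sqrtr.
  have wq : w < Num.sqrt (4 * v).
    apply: le_lt_trans (ler_norm w) _; rewrite -sqrtr_sqr ltr_sqrt //.
    by rewrite (le_lt_trans _ lt) // sqr_ge0.
  move: q2 wq; set q := Num.sqrt _ => q2 wq.
  have T2 : Num.sqrt (q - w) ^+ 2 = q - w by rewrite sqr_sqrtr // subr_ge0 ltW.
  exists (Num.sqrt (q - w)), (q / 2); rewrite T2 g0 /w; split.
  - apply: contra_neq Nn => E.
    have E2 : q = 2 * k by move: E; rewrite /w; lra.
    by move: q2; rewrite E2 /v => ?; lra.
  - by field.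
  - by move: q2; rewrite /v => ?; lra.
pose F : {poly R} := 'X * ('X + w%:P) ^+ 2 - (4 * v)%:P * 'X - (4 * g ^+ 2)%:P.
have FE x : F.[x] = x * (x + w) ^+ 2 - 4 * v * x - 4 * g ^+ 2.
  by rewrite /F !hornerE.
have g2 : 0 < g ^+ 2 by rewrite lt_def sqr_ge0 expf_neq0.
(* F(0) = -4 g^2 < 0, while the upper bound M satisfies M >= 1 and (M + w)^2 - 4 v >= 4 g^2, so F(M)
   >= 0. *)
have [s /andP[s_ge0 _] /rootP Fs] : exists2 s,
    0 <= s <= 1 + `|w| + 4 * `|v| + 4 * g ^+ 2 & root F s.
  apply: poly_ivt.
    by have := normr_ge0 w; have := normr_ge0 v; lra.
  rewrite !FE; apply/andP; split; first by lra.
  have := ler_norm v; have := ler_norm (- w); rewrite normrN.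
  have : 0 <= `|w| := normr_ge0 _; have : 0 <= `|v| := normr_ge0 _.
  set W := `|w|; set V := `|v|; move=> V0 W0 hw hv.
  set M := 1 + W + 4 * V + 4 * g ^+ 2.
  have M1 : 1 <= M by rewrite /M; lra.
  have Q : 1 + 4 * V + 4 * g ^+ 2 <= (M + w) ^+ 2.
    have Q1 : 1 + 4 * V + 4 * g ^+ 2 <= M + w by rewrite /M; lra.
    by nra.
  have Q2 : 4 * g ^+ 2 <= (M + w) ^+ 2 - 4 * v by lra.
  have : 0 <= (M - 1) * ((M + w) ^+ 2 - 4 * v).
    by rewrite mulr_ge0 //; lra.
  by lra.
have sn : s != 0.
  by apply: contraNneq gn => s0; move: Fs; rewrite FE s0 => ?; apply/eqP; nra.
have s_gt0 : 0 < s by rewrite lt_def sn.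
have T2 : Num.sqrt s ^+ 2 = s by rewrite sqr_sqrtr.
have Tn : Num.sqrt s != 0 by rewrite sqrtr_eq0 -ltNge.
move: Fs; rewrite FE => Fs.
have sB : s + B != 0.
  apply: contraNneq G => E.
  have sE : s = - B by lra.
  by move: Fs; rewrite sE /w /v => Fs; apply/eqP; lra.
move: T2 Tn; set T := Num.sqrt s => T2 Tn.
(* This n solves the first equation; the defect in the second is F(T^2) / (4 T^2). *)
exists T, ((T * (T ^+ 2 + w) + 2 * g) / (2 * T)); split.
- by rewrite T2.
- by rewrite /w; field.
- move: Fs; rewrite -T2 /w /v => Fs.
  apply/eqP; rewrite -subr_eq0; apply/eqP.
  transitivity ((T ^+ 2 * (T ^+ 2 + (B + 2 * k)) ^+ 2
    - 4 * (k ^+ 2 + N) * T ^+ 2 - 4 * g ^+ 2) / (4 * T ^+ 2)); first by field.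
  by rewrite Fs mul0r.
Qed.

(** * From pure to general coefficients *)

Lemma sq_solve_pure {R : rcfType} {b c : squat R} :
  sq0 b = 0 -> b != 0 -> (forall k m : R, c != k *: 1 + m *: b) ->
  exists h, h * h + b * h + c = 0.
Proof.
move=> b0 nb nc; pose u : squat R := c - sq0 c *: 1.
have cE : c = sq0 c *: 1 + u by rewrite addrC subrK.
have u0 : sq0 u = 0 by rewrite /u /= mulr1 subrr.
have Nc : sq_norm c = sq0 c ^+ 2 + sq_norm u.
  by rewrite /u; case: (c) => ????; rewrite /sq_norm /=; ring.
have dE : sq_dot b u = sq_dot b c.
  by rewrite /sq_dot /= b0; ring.
have [G|G] := eqVneq (sq_norm b * sq_norm u - sq_dot b c ^+ 2) 0; last first.
  have [T [n [Dn ET En]]] := trace_norm_system (sq0 c) G.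
  by apply: (@sq_solve_trace_norm _ b c T n) => //; rewrite Nc.
have [B0|Bn] := eqVneq (sq_norm b) 0.
  have d0 : sq_dot b u = 0.
    by move/eqP: G; rewrite B0 mul0r sub0r oppr_eq0 sqrf_eq0 dE => /eqP.
  rewrite cE; apply: sq_solve_null => //.
    by rewrite -d0 /sq_dot; ring.
  (* Were [u] null too, it would be a multiple of [b], putting [c] in the span of 1 and [b]. *)
  apply/eqP => Nu; move: (nc (sq0 c) (sq1 u / sq1 b)).
  by rewrite -sq_null_collinear // -cE eqxx.
(* [e], the component of [u] orthogonal to [b], is null because the Gram determinant vanishes. *)
pose m := sq_dot b c / sq_norm b; pose e := u - m *: b.
have -> : c = sq0 c *: 1 + m *: b + e.
  by rewrite {1}cE -addrA /e [m *: b + _]addrC subrK.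
apply: sq_solve_degenerate => //.
- by rewrite /e /= b0; ring.
- by apply: contraNneq (nc (sq0 c) m) => /eqP; rewrite subr_eq0 => /eqP <-; rewrite -cE.
- have -> : sq_norm e = sq_norm u - 2 * m * sq_dot b u + m ^+ 2 * sq_norm b.
    by rewrite /sq_norm /sq_dot /=; ring.
  rewrite dE /m.
  transitivity ((sq_norm b * sq_norm u - sq_dot b c ^+ 2) / sq_norm b).
    by field.
  by rewrite G mul0r.
- have -> : sq_dot b e = sq_dot b u - m * sq_norm b.
    by rewrite /sq_norm /sq_dot /=; ring.
  by rewrite dE divfK // subrr.
Qed.

Lemma sq_solve_monic {R : rcfType} {b c : squat R} :
  (forall k : R, b != k *: 1) -> (forall k m : R, c != k *: 1 + m *: b) ->
  exists h, h * h + b * h + c = 0.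
Proof.
move=> nb nc; pose r := sq0 b / 2; pose b' := b - sq0 b *: 1.
have bE : b = sq0 b *: 1 + b' by rewrite addrC subrK.
(* The constant term after substituting h - r for h, as [sq0 b] is 2 r. *)
have [|||h hE] := @sq_solve_pure R b' (c - (r ^+ 2) *: 1 - r *: b').
- by rewrite /b' /= mulr1 subrr.
- by rewrite subr_eq0.
- move=> k m; apply/eqP => E.
  move: (nc (k + r ^+ 2 - (m + r) * sq0 b) (m + r)); apply/negP/negPn/eqP.
  move/eqP: E; rewrite !subr_eq => /eqP ->; rewrite /b'; move: (sq0 b) => s.
  by case: (b) => ????; apply: sq_eqP => /=; ring.
exists (h - r *: 1); rewrite -hE /b' /r.
by case: (b) (c) (h) => [????] [????] [????]; apply: sq_eqP => /=; field.
Qed.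

(* Invertibility of the leading coefficient is necessary: see
   [factor_lead_unit]. *)
Theorem corollary3p18 (R : realType) (P : {poly squat R}) (a b c : squat R)
    (hP : P = a%:P * 'X^2 + b%:P * 'X + c%:P)
    (ha : a \is a GRing.unit)
    (habc : free [:: a; b; c]) :
  exists h1 h2 : squat R, P = a%:P * ('X - h1%:P) * ('X - h2%:P).
Proof.
(* Reversed so that [free_cons] puts c outside the span of b and a, and b outside that of a. *)
have fcba : free [:: c; b; a] by rewrite (perm_free (permEl (perm_rev [:: a; b; c]))).
move: fcba; rewrite !free_cons => /and3P[nc nb _].
have aK (x : squat R) : x = a * (a^-1 * x) by rewrite mulrA divrr // mul1r.
have [||h hE] := @sq_solve_monic R (a^-1 * b) (a^-1 * c).
- move=> k; apply: contraNneq nb => E.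
  by rewrite [b]aK E -scalerAr mulr1 rpredZ ?memv_span1.
- move=> k m; apply: contraNneq nc => E.
  rewrite [c]aK E mulrDr -!scalerAr mulr1 -aK.
  by rewrite rpredD // rpredZ // memv_span // !inE eqxx ?orbT.
have {}hE : c = - (a * h * h + b * h).
  apply/eqP; rewrite -addr_eq0 addrC; apply/eqP.
  move: (congr1 ( *%R a) hE); rewrite mulr0 !mulrDr -aK => <-.
  by rewrite {1}[b]aK !mulrA.
(* Dividing P by t - h leaves the quotient a t + (b + a h) and the remainder a h^2 + b h + c = 0. *)
exists (- (a^-1 * b) - h), h; rewrite hP [in LHS]hE.
have -> : a%:P * ('X - (- (a^-1 * b) - h)%:P) = a%:P * 'X + (b + a * h)%:P.
  by rewrite mulrBr -polyCM mulrBr mulrN -aK -opprD polyCN opprK.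
have Xh : a%:P * 'X * h%:P = (a * h)%:P * 'X.
  by rewrite -mulrA -(commr_polyX h%:P) mulrA -polyCM.
rewrite mulrBr [in RHS]mulrDl [in X in _ - X]mulrDl Xh -polyCM.
rewrite polyCN (polyCD b) mulrDl ['X^2]expr2 mulrA mulrDl opprD !addrA addrK.
by rewrite [b * h + _]addrC.
Qed.
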